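(* Let $n,k,\ell$ be positive integers, and let $\Gamma=\mathrm{Cay}(\mathbb{Z}_n,\{x^k,x^{-k},x^\ell,x^{-\ell}\})$ be a connected circulant quartic graph. Then: (i) If $k\equiv1\pmod 2$ and $\ell\equiv0\pmod 2$, then $\Gamma$ contains no $(0,4)$-regular set. (ii) If $k\equiv1\pmod 2$ and $\ell\equiv1\pmod 2$, then $\Gamma$ contains a $(0,4)$-regular set if and only if $n$ is a multiple of $2$.
   Context: $\mathbb{Z}_n=\langle x\rangle$ denotes the cyclic group of order $n$, written multiplicatively. For a finite group $G$ with identity $e$ and an inverse-closed subset $S\subseteq G\setminus\{e\}$, the Cayley graph $\mathrm{Cay}(G,S)$ is the simple graph with vertex set $G$ in which $y$ and $z$ are adjacent if and only if $y^{-1}z\in S$. A circulant quartic graph is a graph $\mathrm{Cay}(\mathbb{Z}_n,\{x^k,x^{-k},x^\ell,x^{-\ell}\})$ where $x^k,x^{-k},x^\ell,x^{-\ell}$ are four distinct non-identity elements. For a graph $\Gamma$ and nonnegative integers $a,b$, a nonempty proper subset $C$ of $V(\Gamma)$ is an $(a,b)$-regular set of $\Gamma$ if every vertex in $C$ has exactly $a$ neighbours in $C$ and every vertex in $V(\Gamma)\setminus C$ has exactly $b$ neighbours in $C$. *)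

(* Defs.v *)
From HB Require Import structures.
From mathcomp Require Import all_boot all_fingroup.

Set Implicit Arguments.
Unset Strict Implicit.
Unset Printing Implicit Defensive.

Local Open Scope group_scope.

(* Simple graphs are symmetric irreflexive relations on a finite vertex type. *)

Definition is_connected (V : finType) (e : rel V) : Prop :=
  forall u v : V, connect e u v.

Definition neighbours (V : finType) (e : rel V) (v : V) : {set V} :=
  [set w | e v w].

Definition regular_set (V : finType) (e : rel V) (a b : nat) (C : {set V}) :
    Prop :=
  [/\ C != set0,
      C \proper [set: V],
      forall v, v \in C -> #|neighbours e v :&: C| = a
    & forall v, v \notin C -> #|neighbours e v :&: C| = b].

(* The group is the whole type gT. *)
Definition Cay (gT : finGroupType) (S : {set gT}) : rel gT :=
  fun y z => y^-1 * z \in S.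

Definition circulant_connection (gT : finGroupType) (x : gT) (k l : nat) :
    {set gT} :=
  [set x ^+ k; x ^- k; x ^+ l; x ^- l].

Definition quartic_generators (gT : finGroupType) (x : gT) (k l : nat) : bool :=
  uniq [:: 1; x ^+ k; x ^- k; x ^+ l; x ^- l].

Lemma Cay_sym (gT : finGroupType) (S : {set gT}) :
  (forall s, s \in S -> s^-1 \in S) -> symmetric (Cay S).
Proof.
move=> SV y z; rewrite /Cay; apply/idP/idP => /SV;
  by rewrite invMg invgK.
Qed.

Lemma Cay_irr (gT : finGroupType) (S : {set gT}) :
  1 \notin S -> irreflexive (Cay S).
Proof. by move=> /negbTE S1 y; rewrite /Cay mulVg. Qed.

Lemma circulant_connectionV (gT : finGroupType) (x : gT) (k l : nat) s :
  s \in circulant_connection x k l -> s^-1 \in circulant_connection x k l.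
Proof.
rewrite !inE -!orbA => /or4P[] /eqP ->; rewrite ?invgK eqxx ?orbT //.
Qed.

Lemma circulant_connection1 (gT : finGroupType) (x : gT) (k l : nat) :
  quartic_generators x k l -> 1 \notin circulant_connection x k l.
Proof. by case/andP; rewrite !inE -!orbA. Qed.

(* Main.v *)
Require Import Defs.
From mathcomp Require Import all_boot all_fingroup.
From mathcomp Require Import cyclic.

(** In a 4-valent graph a (0,4)-regular set [C] is one colour class of a proper
    2-colouring: [C] is independent, and all neighbours of a vertex outside [C]
    lie in [C].  In a Cayley graph this says that right translation by each
    generator exchanges [C] with its complement ([regular_set_CayP]), so
    translation by [s ^+ m] preserves [C] exactly when [m] is even, for each
    generator [s] ([mem_alternatingX]).

    Nonexistence comes from computing one translation in two ways.  The element
    [x ^+ (k * l)] is the [l]-th power of [x ^+ k] and the [k]-th power of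
    [x ^+ l], so [k] and [l] have the same parity, which is (i); and [1] is the
    [n]-th power of [x ^+ k], so [n] is even, which is half of (ii).  When [n]
    is even, parity of exponents is well defined on the cyclic group, and the
    even powers of [x] form a set that every odd power of [x] exchanges with its
    complement; this is the other half of (ii). *)

Set Implicit Arguments.
Unset Strict Implicit.
Unset Printing Implicit Defensive.

Local Open Scope group_scope.

(** The degree is taken to be [d] at every vertex, so that [d] neighbours in [C]
    means that all of them are in [C]. *)
Lemma regular_set0P (V : finType) (e : rel V) (d : nat) (C : {set V}) :
  (forall v, #|neighbours e v| = d) ->
  regular_set e 0 d C <->
  [/\ C != set0, C \proper [set: V]
    & forall v w, e v w -> (w \in C) = (v \notin C)].
Proof.
move=> deg; split=> [[C0 CT indep dom] | [C0 CT alt]]; split=> //.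
- move=> v w evw; case: (boolP (v \in C)) => [/indep/eqP | /dom cardN].
    rewrite cards_eq0 => /eqP/setP/(_ w).
    by rewrite !inE evw.
  suff /subsetP sNC : neighbours e v \subset C by apply: sNC; rewrite inE.
  by apply/setIidPl/eqP; rewrite eqEcard subsetIl cardN deg leqnn.
- move=> v vC; apply/eqP; rewrite cards_eq0; apply/eqP/setP=> w; rewrite !inE.
  by apply/andP=> -[/alt->]; rewrite vC.
- move=> v vC; rewrite -(deg v); congr #|pred_of_set _|; apply/setIidPl.
  by apply/subsetP=> w; rewrite inE => /alt->.
Qed.

Lemma card_neighbours_Cay (gT : finGroupType) (S : {set gT}) (v : gT) :
  #|neighbours (Cay S) v| = #|S|.
Proof.
rewrite -(card_lcoset S v); congr #|pred_of_set _|; apply/setP=> w.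
by rewrite inE mem_lcoset.
Qed.

Definition alternating (gT : finGroupType) (C : {set gT}) (s : gT) : Prop :=
  forall v, (v * s \in C) = (v \notin C).

Lemma regular_set_CayP (gT : finGroupType) (S C : {set gT}) :
  regular_set (Cay S) 0 #|S| C <->
  [/\ C != set0, C \proper [set: gT] & {in S, forall s, alternating C s}].
Proof.
apply: (iff_trans (regular_set0P C (card_neighbours_Cay S))).
split=> -[C0 CT alt]; split=> //.
  by move=> s sS v; apply: alt; rewrite /Cay mulKg.
by move=> v w /alt/(_ v); rewrite mulKVg.
Qed.

Lemma alternatingV (gT : finGroupType) (C : {set gT}) (s : gT) :
  alternating C s -> alternating C s^-1.
Proof. by move=> alt v; rewrite -{2}(mulgKV s v) alt negbK. Qed.

Lemma mem_alternatingX (gT : finGroupType) (C : {set gT}) (s v : gT) (m : nat) :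
  alternating C s -> (v * s ^+ m \in C) = odd m (+) (v \in C).
Proof.
move=> alt; elim: m => [|m IHm]; first by rewrite expg0 mulg1.
by rewrite expgSr mulgA alt IHm /= addNb.
Qed.

Lemma alternating_odd_eq (gT : finGroupType) (C : {set gT}) (x : gT)
    (k l : nat) :
  alternating C (x ^+ k) -> alternating C (x ^+ l) -> odd k = odd l.
Proof.
move=> altk altl; apply: (@addIb (1 \in C)).
by rewrite -(mem_alternatingX 1 k altl) -(mem_alternatingX 1 l altk)
  -!expgM mulnC.
Qed.

Lemma alternating_even_order (gT : finGroupType) (C : {set gT}) (x : gT)
    (k : nat) :
  alternating C (x ^+ k) -> ~~ odd #[x].
Proof.
move=> altk; have := mem_alternatingX 1 #[x] altk.
by rewrite expgAC expg_order expg1n mulg1; case: odd; case: (1 \in C).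
Qed.

(** The subgroup of even powers of [x] has index 2 because reduction modulo an
    even order preserves parity. *)
Lemma mem_cycle_sqr (gT : finGroupType) (x : gT) (i : nat) :
  ~~ odd #[x] -> (x ^+ i \in <[x ^+ 2]>) = ~~ odd i.
Proof.
move=> evn; apply/cycleP/idP=> [[j /eqP] | ev_i]; last first.
  by exists i./2; rewrite -expgM mul2n halfK (negbTE ev_i) subn0.
rewrite -expgM eq_expg_mod_order => /eqP/(congr1 odd).
by rewrite !odd_mod ?(negbTE evn) // oddM => ->.
Qed.

Lemma alternating_cycle_sqr (gT : finGroupType) (x : gT) (k : nat) :
  [set: gT] = <[x]> -> ~~ odd #[x] -> odd k ->
  alternating <[x ^+ 2]> (x ^+ k).
Proof.
move=> gen_x evn odd_k v.
have /cycleP[i ->] : v \in <[x]> by rewrite -gen_x inE.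
by rewrite -expgD !mem_cycle_sqr // oddD odd_k addbT.
Qed.

Lemma card_circulant_connection (gT : finGroupType) (x : gT) (k l : nat) :
  quartic_generators x k l -> #|circulant_connection x k l| = 4.
Proof.
rewrite /quartic_generators cons_uniq => /andP[_ /card_uniqP/= <-].
by apply: eq_card => s; rewrite !inE -!orbA.
Qed.

Theorem corollary4p9 (n k l : nat) (n_gt0 : (0 < n)%N) (k_gt0 : (0 < k)%N)
    (l_gt0 : (0 < l)%N) (gT : finGroupType) (x : gT)
    (gen_x : [set: gT] = <[x]>) (ord_x : #[x] = n)
    (quartic : quartic_generators x k l)
    (conn : is_connected (Cay (circulant_connection x k l))) :
  (k = 1 %[mod 2] -> l = 0 %[mod 2] ->
     ~ exists C : {set gT}, regular_set (Cay (circulant_connection x k l)) 0 4 C)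
  /\
  (k = 1 %[mod 2] -> l = 1 %[mod 2] ->
     ((exists C : {set gT}, regular_set (Cay (circulant_connection x k l)) 0 4 C)
        <-> (2 %| n)%N)).
Proof.
have parity m b : m = nat_of_bool b %[mod 2] -> odd m = b.
  by rewrite !modn2 oddb; case: (odd m); case: b.
rewrite -(card_circulant_connection quartic) dvdn2 -ord_x.
set S := circulant_connection x k l.
have xkS : x ^+ k \in S by rewrite !inE eqxx.
have xlS : x ^+ l \in S by rewrite !inE eqxx ?orbT.
split=> [/(parity k true) odd_k /(parity l false) ev_l |
         /(parity k true) odd_k /(parity l true) odd_l].
  case=> C /regular_set_CayP[_ _ alt].
  by have := alternating_odd_eq (alt _ xkS) (alt _ xlS);
    rewrite odd_k ev_l.
split=> [[C /regular_set_CayP[_ _ alt]] | evn].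
  exact: alternating_even_order (alt _ xkS).
exists <[x ^+ 2]>; apply/regular_set_CayP; split.
- by apply/set0Pn; exists 1; rewrite group1.
- rewrite properT; apply/eqP=> /setP/(_ x).
  by rewrite -{1}(expg1 x) mem_cycle_sqr // inE.
- have [altk altl] := (alternating_cycle_sqr gen_x evn odd_k,
                       alternating_cycle_sqr gen_x evn odd_l).
  by move=> s; rewrite !inE -!orbA => /or4P[] /eqP->; do ?apply: alternatingV.
Qed.
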